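(* Let $\mathcal{H}$ be a complex Hilbert space, let $Q\subset\mathbb{C}^n$ be a complete circular domain centered at $0\in Q$, and let $f:Q\to\mathcal{B}(\mathcal{H})$ be given by a series of homogeneous polynomials $f(z)=\sum_{k=0}^{\infty}P_k(z)$ converging in $Q$, such that $\|f(z)\|<1$ for all $z\in Q$ and $f(0)=a_0I$ with $a_0\in\mathbb{C}$, $|a_0|<1$. Then $$\sum_{k=0}^{\infty}\|P_k(z)\|+\left(\frac{1}{1+\|f(0)\|}+\frac{r}{1-r}\right)\sum_{k=1}^{\infty}\|P_k(z)\|^2\le 1$$ for all $z\in rQ$ with $0\le r\le 1/3$ (in particular throughout the homothetic domain $(1/3)Q$). Moreover, if $Q$ is convex, then $1/3$ is the best possible, i.e. for every $r\in(1/3,1)$ there is a function $f:Q\to\mathcal{B}(\mathcal{H})$, given by a series of homogeneous polynomials $f(z)=\sum_{k=0}^{\infty}P_k(z)$ converging in $Q$, with $\|f(z)\|<1$ for all $z\in Q$ and $f(0)=a_0I$ for some $a_0\in\mathbb{C}$, $|a_0|<1$, for which the inequality (with this $r$) fails at some point $z\in rQ$.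
   Context: $\mathcal{B}(\mathcal{H})$ is the algebra of all bounded linear operators on $\mathcal{H}$ with the operator norm $\|\cdot\|$, and $I$ is the identity operator. A domain $Q\subset\mathbb{C}^n$ is a complete circular domain centered at $0\in Q$ if for each $z=(z_1,\dots,z_n)\in Q$ and each $\xi\in\mathbb{C}$ with $|\xi|\le 1$ one has $(\xi z_1,\dots,\xi z_n)\in Q$. Every analytic function $f:Q\to\mathcal{B}(\mathcal{H})$ has an expansion $f(z)=\sum_{k=0}^\infty P_k(z)$, where $P_k(z)=\sum_{|\alpha|=k}A_\alpha z^\alpha$, $A_\alpha\in\mathcal{B}(\mathcal{H})$ (standard multi-index notation), is a homogeneous polynomial of degree $k$ and $P_0(z)=f(0)$. For $r\ge 0$, $rQ=\{rz: z\in Q\}$.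
   Formalization: The sharpness of 1/3 is stated only for convex Q different from all of C^n and for H nonzero: if Q = C^n, Liouville makes f constant, and if H = {0}, all norms vanish, so in these cases the inequality never fails. *)

(* Defs.v *)
From HB Require Import structures.
From mathcomp Require Export all_boot all_order all_algebra.
From mathcomp Require Export sesquilinear complex.
From mathcomp Require Export all_classical all_reals all_analysis.

Set Implicit Arguments.
Unset Strict Implicit.
Unset Printing Implicit Defensive.

Import Order.TTheory GRing.Theory Num.Theory.
Import numFieldNormedType.Exports.

Local Open Scope classical_set_scope.
Local Open Scope complex_scope.
Local Open Scope ring_scope.

(* The instances of numFieldNormedType cover only abstract structures; this is
   the same transfer for the concrete field R[i]. *)
HB.instance Definition _ (R : rcfType) := PseudoPointedMetric.copy R[i] R[i]^o.

Section Operators.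
Context {R : realType} {H : completeNormedModType R[i]}.
Implicit Types T : H -> H.

Definition bounded_operator T :=
  linear T /\ exists M : R, forall x, `|T x| <= M%:C * `|x|.

(* Norms in H are nonnegative elements of R[i]; [Re] brings them back to R.
   The supremum is meaningful only for bounded operators. *)
Definition opnorm T : R :=
  sup [set complex.Re `|T x| | x in [set x : H | `|x| <= 1]].

End Operators.

Section HomogeneousExpansions.
Context {R : realType} {H : completeNormedModType R[i]} {n : nat}.
Implicit Types (Q : set 'rV[R[i]]_n) (z : 'rV[R[i]]_n).

Definition complete_circular_domain Q :=
  [/\ open Q, connected Q, Q 0 &
      forall z (xi : R[i]), Q z -> `|xi| <= 1 -> Q (xi *: z)].

Definition homothetic (r : R) Q := [set r%:C *: z | z in Q].

(* The multi-indices of length k are enumerated by the finite functions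
   'I_n -> 'I_k.+1 of total sum k, since all their entries are at most k. *)
Definition homogeneous_part (A : {ffun 'I_n -> nat} -> H -> H) (k : nat) z :
    H -> H :=
  \sum_(a : {ffun 'I_n -> 'I_k.+1} | (\sum_(i < n) a i)%N == k)
    (\prod_(i < n) z 0 i ^+ a i) *: A [ffun i => a i : nat].

(* f is B(H)-valued on Q and is there the sum, in operator norm, of its
   homogeneous parts; the values of f outside Q are irrelevant. *)
Definition homogeneous_expansion Q (f : 'rV[R[i]]_n -> H -> H)
    (A : {ffun 'I_n -> nat} -> H -> H) :=
  [/\ forall a, bounded_operator (A a),
      forall z, Q z -> bounded_operator (f z) &
      forall z, Q z ->
        opnorm (f z - \sum_(k < N) homogeneous_part A k z) @[N --> \oo]
          --> (0 : R)].

Definition bohr_admissible Q f A (a0 : R[i]) :=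
  [/\ homogeneous_expansion Q f A,
      forall z, Q z -> opnorm (f z) < 1,
      f 0 = a0 *: idfun & `|a0| < 1].

(* The sums of nonnegative terms are taken in the extended reals, so the
   inequality includes their convergence. *)
Definition bohr_inequality (f : 'rV[R[i]]_n -> H -> H)
    (A : {ffun 'I_n -> nat} -> H -> H) (r : R) z :=
  (\sum_(0 <= k <oo) (opnorm (homogeneous_part A k z))%:E +
   (1 / (1 + opnorm (f 0)) + r / (1 - r))%:E *
   \sum_(1 <= k <oo) (opnorm (homogeneous_part A k z) ^+ 2)%:E <= 1)%E.

End HomogeneousExpansions.

(* Main.v *)
(* Restrict f to the complex line through w in Q: g(xi) = f(xi w) has the
   coefficients P_k(w) and is contractive on the closed unit disc.  Multiplying g
   by the vector polynomial x + xi^k y and comparing mean squares over roots of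
   unity gives |P_0 x|^2 + |P_k x + P_0 y|^2 <= |x|^2 + |y|^2.  As P_0 = a_0 I,
   the choice y = conj(a_0) / (1 - |a_0|^2) P_k x yields
   |P_k(w)| <= 1 - |a_0|^2, and for r <= 1/3 these bounds and geometric sums
   already imply the inequality.

   For sharpness take the point u outside Q nearest to 0 (Euclidean norm).
   Convexity makes l(z) = <z, u> / |u|^2 satisfy |l| < 1 on Q, whereas s u is in
   Q and l(s u) = s for all s < 1.  Then f = (a - l) / (1 - a l) I violates the
   inequality at r s u as soon as r s (1 + 2 a) > 1. *)

Require Import Defs.
From mathcomp Require Import ring lra cyclic separable cyclotomic.

Set Implicit Arguments.
Unset Strict Implicit.
Unset Printing Implicit Defensive.

Import Order.TTheory GRing.Theory Num.Theory.
Import numFieldNormedType.Exports.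

Local Open Scope classical_set_scope.
Local Open Scope complex_scope.
Local Open Scope ring_scope.

(** ['X^n - 1] splits and, as [n] is nonzero in characteristic 0, is separable; [n] distinct [n]-th
    roots of unity in a field include a primitive one. *)
Lemma prim_root_exists (C : numClosedFieldType) n :
  (0 < n)%N -> exists w : C, n.-primitive_root w.
Proof.
pose p : {poly C} := 'X^n - 1; have [r Dp] := closed_field_poly_normal p.
move=> n_gt0; rewrite (monicP _) ?monicXnsubC // scale1r in Dp.
have rn1 : all n.-unity_root r by apply/allP=> z; rewrite -root_prod_XsubC -Dp.
have sz_r : (n < (size r).+1)%N.
  by rewrite -(size_prod_XsubC r id) -Dp size_XnsubC.
have [|z] := hasP (has_prim_root n_gt0 rn1 _ sz_r); last by exists z.
by rewrite -separable_prod_XsubC -Dp separable_Xn_sub_1 // pnatr_eq0 -lt0n.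
Qed.

(** * Norms as real numbers instead of elements of [R[i]] *)

Section RealNorm.
Context {R : realType}.

Definition rnorm {V : normedZmodType R[i]} (x : V) : R := complex.Re `|x|.

Lemma rnormE (V : normedZmodType R[i]) (x : V) : `|x| = (rnorm x)%:C.
Proof. by rewrite /rnorm RRe_real// ger0_real. Qed.

Lemma rnorm_ge0 (V : normedZmodType R[i]) (x : V) : 0 <= rnorm x.
Proof. by rewrite -ler0c -rnormE. Qed.

Lemma rnorm0 (V : normedZmodType R[i]) : rnorm (0 : V) = 0.
Proof. by rewrite /rnorm normr0. Qed.

Lemma rnormN (V : normedZmodType R[i]) (x : V) : rnorm (- x) = rnorm x.
Proof. by rewrite /rnorm normrN. Qed.

Lemma ler_rnormD (V : normedZmodType R[i]) (x y : V) :
  rnorm (x + y) <= rnorm x + rnorm y.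
Proof. by rewrite -lecR rmorphD /= -!rnormE ler_normD. Qed.

Lemma rnorm1 : rnorm (1 : R[i]) = 1.
Proof. by rewrite /rnorm normr1. Qed.

Lemma rnormM (x y : R[i]) : rnorm (x * y) = rnorm x * rnorm y.
Proof. by apply: complexI; rewrite rmorphM /= -!rnormE normrM. Qed.

Lemma rnormX (x : R[i]) k : rnorm (x ^+ k) = rnorm x ^+ k.
Proof. by apply: complexI; rewrite rmorphXn /= -!rnormE normrX. Qed.

Lemma rnorm_real (x : R) : rnorm (x%:C : R[i]) = `|x|.
Proof. by rewrite /rnorm normc_def /= expr0n /= addr0 sqrtr_sqr. Qed.

Lemma rnormZ (V : normedModType R[i]) (c : R[i]) (x : V) :
  rnorm (c *: x) = rnorm c * rnorm x.
Proof. by apply: complexI; rewrite rmorphM /= -!rnormE normrZ. Qed.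

Lemma rnorm_eq0 (V : normedZmodType R[i]) (x : V) : rnorm x = 0 -> x = 0.
Proof. by move=> h; apply/eqP; rewrite -normr_eq0 rnormE h. Qed.

Lemma mulC_conj (z : R[i]) : z * z^* = (rnorm z ^+ 2)%:C.
Proof. by rewrite rmorphXn /= -rnormE -normCK. Qed.

End RealNorm.

(** * Discrete Parseval identity over roots of unity *)

Section Parseval.
Context {R : realType} {H : normedModType R[i]}.
Variable dot : {dot H for Num.conj}.
Hypothesis dot_norm : forall x : H, dot x x = `|x| ^+ 2.

Lemma norm_prim_root n (w : R[i]) : n.-primitive_root w -> `|w| = 1.
Proof.
move=> pw; have n0 := prim_order_gt0 pw.
apply/eqP; rewrite -(@pexpr_eq1 _ _ n)// -normrX prim_expr_order//.
by rewrite normr1.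
Qed.

(** As [w] is unimodular, its conjugate is its inverse, so the sum is geometric with ratio [q] =
    [w ^+ m / w ^+ l]. Here [q ^+ n = 1], and [q] differs from 1 unless [m = l]. *)
Lemma sum_prim_root n (w : R[i]) (m l : nat) : n.-primitive_root w ->
  (m < n)%N -> (l < n)%N ->
  \sum_(j < n) w ^+ (j * m) * (w ^+ (j * l))^*%R = (n%:R *+ (m == l) : R[i]).
Proof.
move=> pw mn ln; have w1 := norm_prim_root pw.
have w0 : w != 0 by rewrite -normr_eq0 w1 oner_eq0.
have conjw : (w^*)%R = w^-1.
  by apply: (mulfI w0); rewrite divff// -normCK w1 expr1n.
pose q := w ^+ m / w ^+ l.
transitivity (\sum_(j < n) q ^+ j).
  apply: eq_bigr => j _; rewrite rmorphXn /= conjw /q exprVn.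
  by rewrite expr_div_n -!exprM !(mulnC j).
have [eml|ml] := eqVneq m l.
  rewrite mulr1n (eq_bigr (fun=> 1)); last first.
    by move=> j _; rewrite /q eml divff ?expf_neq0// expr1n.
  by rewrite sumr_const card_ord.
have q1 : q != 1.
  apply: contra ml => /eqP /divr1_eq /eqP.
  by rewrite (eq_prim_root_expr pw) !modn_small.
have qn : q ^+ n = 1.
  rewrite /q expr_div_n -!exprM (mulnC m) (mulnC l) !exprM.
  by rewrite (prim_expr_order pw) !expr1n divr1.
rewrite mulr0n; apply: (@mulfI _ (q - 1)); first by rewrite subr_eq0.
by rewrite -subrX1 qn subrr mulr0.
Qed.

(** Expanding the squared norms through [dot], the orthogonality relation [sum_prim_root] removes
    all cross terms. *)
Lemma parseval n (w : R[i]) (c : nat -> H) : n.-primitive_root w ->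
  \sum_(j < n) rnorm (\sum_(m < n) w ^+ (j * m) *: c m) ^+ 2 =
  n%:R * \sum_(m < n) rnorm (c m) ^+ 2.
Proof.
move=> pw; apply: complexI; rewrite rmorphM !rmorph_sum /= rmorph_nat.
transitivity (\sum_(j < n) \sum_(m < n) \sum_(l < n)
    w ^+ (j * m) * (w ^+ (j * l))^*%R * dot (c m) (c l)).
  apply: eq_bigr => j _; rewrite rmorphXn /= -rnormE -dot_norm linear_sumlz /=.
  apply: eq_bigr => m _; rewrite linear_sumr /=.
  apply: eq_bigr => l _; rewrite linearZl_LR linearZr_LR /=.
  by rewrite mulrA.
rewrite exchange_big /= mulr_sumr; apply: eq_bigr => m _.
rewrite exchange_big /= (bigD1 m)//= [X in _ + X]big1 ?addr0 => [|l lm].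
  rewrite -mulr_suml sum_prim_root// eqxx mulr1n.
  by rewrite dot_norm rnormE rmorphXn.
by rewrite -mulr_suml sum_prim_root// eq_sym val_eqE (negPf lm) mulr0n mul0r.
Qed.

End Parseval.

(** Convergence at the single point [rho] makes the coefficients decay like [rho^-N], so the tails
    on the unit circle have a geometric bound independent of [xi]. *)
Lemma power_series_unif_cvg {R : realType} {V : normedModType R[i]}
    (b : nat -> V) (g : R[i] -> V) (rho : R) : 1 < rho ->
  (forall xi : R[i], rnorm xi <= rho ->
    rnorm (g xi - \sum_(k < N) xi ^+ k *: b k) @[N --> \oo] --> (0 : R)) ->
  forall e : R, 0 < e -> \forall N \near \oo, forall xi : R[i], rnorm xi = 1 ->
    rnorm (g xi - \sum_(k < N) xi ^+ k *: b k) <= e.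
Proof.
move=> rho1 gb e e0; pose q := rho^-1.
have rho0 : 0 < rho by rewrite (lt_trans _ rho1).
have q0 : 0 < q by rewrite invr_gt0.
have q1 : q < 1 by rewrite invf_lt1.
pose S xi N := \sum_(k < N) xi ^+ k *: b k.
have near_le xi : rnorm xi <= rho -> forall d : R, 0 < d ->
    exists J, forall N, (J <= N)%N -> rnorm (g xi - S xi N) <= d.
  move=> xile d d0; have /cvgr0Pnorm_le/(_ d d0) [J _ hJ] := gb _ xile.
  by exists J => N /hJ; rewrite ger0_norm ?rnorm_ge0.
have Ssub xi N d : rnorm (S xi (N + d)%N - S xi N) <=
    rnorm (g xi - S xi N) + rnorm (g xi - S xi (N + d)%N).
  have -> : S xi (N + d)%N - S xi N = (g xi - S xi N) - (g xi - S xi (N + d)%N).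
    by rewrite opprB [RHS]addrC addrA subrK.
  by rewrite (le_trans (ler_rnormD _ _))// rnormN.
have rhoE : rnorm (rho%:C : R[i]) = rho by rewrite rnorm_real gtr0_norm.
have [|J hJ] := near_le rho%:C _ 1 ltr01; first by rewrite rhoE.
(* The term of index [N] at [rho] is the difference of two consecutive partial sums, both within 1
   of [g rho]. *)
have bq N : (J <= N)%N -> rnorm (b N) <= 2 * q ^+ N.
  move=> JN; have := Ssub rho%:C N 1; rewrite addn1 {1}/S big_ord_recr /=.
  rewrite -/(S _ N) addrAC subrr add0r rnormZ rnormX rhoE => h.
  rewrite /q exprVn ler_pdivlMr ?exprn_gt0// mulrC.
  by rewrite (le_trans h)// -[2]/(1 + 1) lerD// hJ// leqW.
(* The right-hand side is the closed form of the sum of [2 * q ^+ j] over [N <= j < N + d], which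
   lets the induction on [d] close. *)
have tail xi N d : rnorm xi = 1 -> (J <= N)%N ->
    rnorm (S xi (N + d)%N - S xi N) <= 2 * (q ^+ N - q ^+ (N + d)) / (1 - q).
  move=> xi1 JN; elim: d => [|d IHd].
    by rewrite addn0 !subrr rnorm0 mulr0 mul0r.
  rewrite addnS {1}/S big_ord_recr /= -/(S _ _) addrAC.
  rewrite (le_trans (ler_rnormD _ _))// rnormZ rnormX xi1 expr1n mul1r.
  have := bq (N + d)%N (leq_trans JN (leq_addr _ _)).
  move=> /(lerD IHd)/le_trans; apply.
  rewrite exprS le_eqVlt; apply/orP; left; apply/eqP.
  by field; rewrite subr_eq0 gt_eqF.
have : (fun N => 2 * q ^+ N / (1 - q)) @ \oo --> 2 * 0 / (1 - q).
  by apply: cvgMl; apply: cvgMr; apply: cvg_expr; rewrite gtr0_norm.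
rewrite mulr0 mul0r => /cvgr0Pnorm_le/(_ (e / 2)); rewrite divr_gt0// => /(_ isT).
move=> [N1 _ hN1]; exists (maxn J N1) => // N /=; rewrite geq_max => /andP[JN NN].
(* [K] depends on [xi], but the bound on the partial sum from [N] to [N + K] does not depend on [K],
   so [N] stays uniform. *)
move=> xi xi1; have [|K hK] := near_le xi _ (e / 2) (divr_gt0 e0 (ltr0Sn _ 1)).
  by rewrite xi1 ltW.
have -> : g xi - \sum_(k < N) xi ^+ k *: b k =
    (g xi - S xi (N + K)%N) + (S xi (N + K)%N - S xi N).
  by rewrite addrA subrK.
rewrite (le_trans (ler_rnormD _ _))// (splitr e) lerD// ?hK ?leq_addl//.
rewrite (le_trans (tail _ _ _ xi1 JN))//.
apply: le_trans (le_trans (ler_norm _) (hN1 N NN)).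
rewrite ler_pM2r ?invr_gt0 ?subr_gt0// ler_pM2l// gerBl.
by rewrite exprn_ge0// ltW.
Qed.

Lemma sum_split2 (V : nmodType) (F : nat -> V) k n : (0 < k < n)%N ->
  \sum_(m < n) F m =
  F 0%N + F k + \sum_(m < n | (m != 0 :> nat) && (m != k :> nat)) F m.
Proof.
move=> /andP[k0 kn]; have n0 : (0 < n)%N by rewrite (leq_trans _ kn).
rewrite (bigD1 (Ordinal n0))//= (bigD1 (Ordinal kn))/=; last first.
  by rewrite -val_eqE /= -lt0n.
by rewrite addrA.
Qed.

(** * Coefficient estimates for contractive operator power series *)

Section ContractiveSeries.
Context {R : realType} {H : normedModType R[i]}.
Variable dot : {dot H for Num.conj}.
Hypothesis dot_norm : forall x : H, dot x x = `|x| ^+ 2.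
Variables (b : nat -> H -> H) (g : R[i] -> H -> H) (rho : R).
Hypothesis g_linear : forall xi, rnorm xi = 1 -> linear (g xi).
Hypothesis rho1 : 1 < rho.
Hypothesis b_cvg : forall x (xi : R[i]), rnorm xi <= rho ->
  rnorm (g xi x - \sum_(k < N) xi ^+ k *: b k x) @[N --> \oo] --> (0 : R).
Hypothesis g_contr : forall xi x, rnorm xi = 1 -> rnorm (g xi x) <= rnorm x.

(* The 2 x 2 lower triangular Toeplitz block with entries b_0 and b_k is a
   contraction: apply the series to the vector polynomial x + xi^k y and
   compare mean squares over the roots of unity. *)
Lemma toeplitz_contraction k x y : (0 < k)%N ->
  rnorm (b 0%N x) ^+ 2 + rnorm (b k x + b 0%N y) ^+ 2 <=
  rnorm x ^+ 2 + rnorm y ^+ 2.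
Proof.
move=> k0; apply/ler_addgt0Pr => e e0.
pose s := rnorm x + rnorm y.
have s0 : 0 <= s by rewrite addr_ge0 ?rnorm_ge0.
(* The truncation error [d] is chosen so that [(t + d) ^+ 2 <= t ^+ 2 + e] whenever [0 <= t <= s];
   the minimum with 1 gives [d ^+ 2 <= d]. *)
pose d := Num.min 1 (e / (2 * s + 1)).
have d0 : 0 < d by rewrite lt_min ltr01 divr_gt0// ltr_wpDl// mulr_ge0.
have de : 2 * s * d + d ^+ 2 <= e.
  have d1 : d <= 1 by rewrite ge_min lexx.
  have : d <= e / (2 * s + 1) by rewrite ge_min lexx orbT.
  rewrite ler_pdivlMr ?ltr_wpDl ?mulr_ge0// => h.
  by apply: le_trans h; nra.
have unif v := @power_series_unif_cvg R H (b^~ v) (g^~ v) rho rho1 (b_cvg v) _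
  (divr_gt0 d0 (ltr0Sn R 1)).
have [N1 _ h1] := unif x; have [N2 _ h2] := unif y.
pose N := maxn k.+1 (maxn N1 N2).
have kN : (k < N)%N by rewrite /N leq_max leqnn.
have {h1}hx : forall xi : R[i], rnorm xi = 1 ->
    rnorm (g xi x - \sum_(k < N) xi ^+ k *: b k x) <= d / 2.
  by apply: h1; rewrite /= /N !leq_max leqnn !orbT.
have {h2}hy : forall xi : R[i], rnorm xi = 1 ->
    rnorm (g xi y - \sum_(k < N) xi ^+ k *: b k y) <= d / 2.
  by apply: h2; rewrite /= /N !leq_max leqnn !orbT.
(* A polynomial of degree below [N] times x + xi^k y has degree below [N + k], so [M]-th roots of
   unity separate all its coefficients, which are [c1 m + c2 m] below. *)
pose M := (N + k)%N.
have M0 : (0 < M)%N by rewrite addn_gt0 k0 orbT.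
have kM : (0 < k < M)%N by rewrite k0 ltn_addr.
have [w pw] := @prim_root_exists R[i] M M0.
have rw j : rnorm (w ^+ j) = 1.
  by rewrite rnormX /rnorm (norm_prim_root pw) expr1n.
pose c1 m := if (m < N)%N then b m x else 0.
pose c2 m := if (k <= m)%N then b (m - k)%N y else 0.
pose p m := if m == 0%N then x else if m == k then y else 0.
have sum_p j : \sum_(m < M) w ^+ (j * m) *: p m = x + w ^+ (j * k) *: y.
  rewrite (sum_split2 (fun m => w ^+ (j * m) *: p m) kM) big1 ?addr0.
    by rewrite muln0 expr0 scale1r /p /= eqxx gtn_eqF.
  by move=> m /andP[/negPf m0 /negPf mk]; rewrite /p m0 mk scaler0.
have sum_c j : \sum_(m < M) w ^+ (j * m) *: (c1 m + c2 m) =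
    \sum_(m < N) (w ^+ j) ^+ m *: b m x +
    w ^+ (j * k) *: \sum_(m < N) (w ^+ j) ^+ m *: b m y.
  under eq_bigr do rewrite scalerDr.
  rewrite big_split /=; congr (_ + _).
    rewrite big_split_ord /= [X in _ + X]big1 ?addr0; last first.
      by move=> m _; rewrite /c1 ltnNge leq_addr /= scaler0.
    by apply: eq_bigr => m _; rewrite /c1 ltn_ord exprM.
  rewrite /M addnC big_split_ord /= [X in X + _]big1 ?add0r; last first.
    by move=> m _; rewrite /c2 leqNgt ltn_ord /= scaler0.
  rewrite scaler_sumr; apply: eq_bigr => m _.
  by rewrite /c2 leq_addr addKn scalerA mulnDr exprD !exprM.
have sum_le j : rnorm (\sum_(m < M) w ^+ (j * m) *: (c1 m + c2 m)) ^+ 2 <=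
    rnorm (\sum_(m < M) w ^+ (j * m) *: p m) ^+ 2 + e.
  rewrite sum_c sum_p.
  set X := \sum_(m < N) _ *: b _ x; set Y := \sum_(m < N) _ *: b _ y.
  set v := x + _; set eta := w ^+ (j * k) in v *.
  have gv : g (w ^+ j) v = g (w ^+ j) x + eta *: g (w ^+ j) y.
    by rewrite /v addrC (g_linear (rw j)) addrC.
  (* The truncated product is the exact value of [g] at [v] plus two truncation errors of size at
     most [d / 2] each. *)
  have -> : X + eta *: Y =
      g (w ^+ j) v + (- (g (w ^+ j) x - X) - eta *: (g (w ^+ j) y - Y)).
    rewrite gv scalerBr !opprB addrACA; congr (_ + _); last by rewrite addrC subrK.
    by rewrite addrC subrK.
  have vs : rnorm v <= s.
    by rewrite (le_trans (ler_rnormD _ _))// rnormZ rw mul1r.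
  have le1 : rnorm (g (w ^+ j) v + (- (g (w ^+ j) x - X) -
      eta *: (g (w ^+ j) y - Y))) <= rnorm v + d.
    rewrite (le_trans (ler_rnormD _ _))// lerD// ?g_contr ?rw//.
    rewrite (le_trans (ler_rnormD _ _))// (splitr d) !rnormN lerD ?hx ?rw//.
    by rewrite rnormZ rw mul1r hy ?rw.
  have := rnorm_ge0 v; move: le1; set u := rnorm (_ + _) => le1 v0.
  have u0 : 0 <= u by exact: rnorm_ge0.
  by nra.
have : \sum_(j < M) rnorm (\sum_(m < M) w ^+ (j * m) *: (c1 m + c2 m)) ^+ 2 <=
    \sum_(j < M) (rnorm (\sum_(m < M) w ^+ (j * m) *: p m) ^+ 2 + e).
  by apply: ler_sum => j _; exact: sum_le.
rewrite big_split /= sumr_const card_ord -(mulr_natl e).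
rewrite (parseval dot_norm (fun m => c1 m + c2 m) pw) (parseval dot_norm p pw).
rewrite -mulrDr ler_pM2l ?ltr0n//.
(* On the left only the coefficients of index 0 and [k] are kept; they are [b 0 x] and
   [b k x + b 0 y], because [0 < k < N]. *)
rewrite (sum_split2 (fun m => rnorm (c1 m + c2 m) ^+ 2) kM).
rewrite (sum_split2 (fun m => rnorm (p m) ^+ 2) kM) [X in _ <= _ + X + _]big1.
  rewrite addr0 /p eqxx gtn_eqF// eqxx; apply: le_trans.
  rewrite {1 2}/c1 {1 2}/c2 (leq_ltn_trans _ kN)// kN leqnn subnn leqNgt k0 /=.
  by rewrite addr0 lerDl sumr_ge0// => m _; rewrite sqr_ge0.
by move=> m /andP[/negPf m0 /negPf mk]; rewrite /p m0 mk rnorm0 expr0n.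
Qed.

(** With [t = 1 - A ^+ 2], the chosen second vector y satisfies B + a y = B / t, and the Toeplitz
    inequality collapses to |B|^2 / t <= t |x|^2. *)
Lemma contractive_series_coef_le (a : R[i]) k x : (0 < k)%N ->
  (forall v, b 0%N v = a *: v) -> rnorm a < 1 ->
  rnorm (b k x) <= (1 - rnorm a ^+ 2) * rnorm x.
Proof.
move=> k0 b0 a1; set B := b k x; set A := rnorm a.
have A0 : 0 <= A := rnorm_ge0 _.
pose t := 1 - A ^+ 2.
have t0 : 0 < t by rewrite subr_gt0 expr_lt1.
have := toeplitz_contraction x (((a^*)%R / t%:C) *: B) k0.
rewrite !b0 -/B scalerA -{1}(scale1r B) -scalerDl mulrA mulC_conj -/A.
have -> : 1 + (A ^+ 2)%:C / t%:C = (t^-1)%:C.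
  rewrite fmorphV /=.
  have -> : (A ^+ 2)%:C = 1 - t%:C by rewrite /t rmorphB /= rmorph1 subKr.
  have : (t%:C : R[i]) != 0 by rewrite fmorph_eq0 gt_eqF.
  by move=> ?; field.
rewrite !rnormZ rnormM -/A rnorm_real.
have -> : rnorm (a^*)%R = A by rewrite /A /rnorm norm_conjC.
have -> : rnorm (t%:C^-1 : R[i]) = t^-1.
  by rewrite -fmorphV /= rnorm_real gtr0_norm// invr_gt0.
rewrite gtr0_norm ?invr_gt0// => h.
have B0 : 0 <= rnorm B := rnorm_ge0 _; have X0 : 0 <= rnorm x := rnorm_ge0 _.
rewrite -(@ler_pXn2r _ 2) ?nnegrE ?mulr_ge0// -?/t ?(ltW t0)//.
have h1 : (t^-1 * rnorm B) ^+ 2 * t <= t * rnorm x ^+ 2.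
  by move: h; rewrite /t; nra.
move: h1; rewrite [X in _ <= X]mulrC ler_pM2r// !exprMn exprVn.
by rewrite mulrC ler_pdivrMr ?exprn_gt0// mulrC.
Qed.

End ContractiveSeries.

(** * Neighbourhoods and dilations in circular domains *)

Lemma open_rV_ball (R : realType) n (Q : set 'rV[R[i]]_n) (z : 'rV[R[i]]_n) :
  open Q -> Q z -> exists2 e : R, 0 < e &
    forall z' : 'rV[R[i]]_n, (forall i, rnorm (z 0 i - z' 0 i) < e) -> Q z'.
Proof.
move=> oQ Qz; have := @open_nbhs_nbhs _ z Q (conj oQ Qz).
move/nbhs_ballP => [e /= e0 he].
have eE : e = (complex.Re e)%:C by rewrite RRe_real// gtr0_real.
exists (complex.Re e); first by rewrite -ltcR -eE.
move=> z' h; apply: he; split=> // i j.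
suff : @ball _ R[i]^o (z i j) e (z' i j) by [].
by rewrite -ball_normE /= (ord1 i) rnormE eE ltcR.
Qed.

(** Openness at [w] yields one real dilate [rho *: w] in [Q], and circularity fills the disc. The
    radius beyond 1 is what [power_series_unif_cvg] requires of a slice of [f]. *)
Lemma circular_domain_dilate (R : realType) n (Q : set 'rV[R[i]]_n)
    (w : 'rV[R[i]]_n) : complete_circular_domain Q -> Q w ->
  exists2 rho : R, 1 < rho & forall xi : R[i], rnorm xi <= rho -> Q (xi *: w).
Proof.
move=> [oQ _ _ cQ] Qw; have [e e0 he] := open_rV_ball oQ Qw.
pose s := \sum_i rnorm (w 0 i).
have s0 : 0 <= s by apply: sumr_ge0 => i _; exact: rnorm_ge0.
have s1 : 0 < 1 + s by rewrite ltr_pwDl.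
(* Each coordinate of [w] has norm at most [s], so it moves by at most [e * s / (1 + s) < e]. *)
pose rho := 1 + e / (1 + s).
have rho1 : 1 < rho by rewrite ltrDl divr_gt0.
have rho0 : 0 < rho by rewrite (lt_trans _ rho1).
have Qrho : Q (rho%:C *: w).
  apply: he => i; rewrite mxE -[w 0 i in X in X - _]mul1r -mulrBl rnormM.
  rewrite /rho rmorphD rmorph1 /= opprD addNKr rnormN rnorm_real.
  rewrite gtr0_norm ?divr_gt0// mulrAC ltr_pdivrMr// ltr_pM2l//.
  rewrite ltr_pwDl// /s (bigD1 i)//= lerDl sumr_ge0// => j _; exact: rnorm_ge0.
exists rho => // xi xirho.
have -> : xi *: w = (xi / rho%:C) *: (rho%:C *: w).
  by rewrite scalerA divfK// fmorph_eq0 gt_eqF.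
apply: cQ => //; rewrite rnormE rnormM -fmorphV /= rnorm_real.
by rewrite gtr0_norm ?invr_gt0// lecR ler_pdivrMr// mul1r.
Qed.

(** * Bounded operators and their norm *)

Section OperatorNorm.
Context {R : realType} {H : completeNormedModType R[i]}.
Implicit Types S T : H -> H.

Lemma opnorm_le T (c : R) : 0 <= c ->
  (forall x, rnorm (T x) <= c * rnorm x) -> opnorm T <= c.
Proof.
move=> c0 h; apply: ge_sup.
  by exists (complex.Re `|T 0|), 0 => //=; rewrite normr0.
move=> _ [x /= x1 <-]; rewrite (le_trans (h x))// ler_piMr//.
by rewrite -lecR -rnormE.
Qed.

Lemma opnorm_ge0 T : 0 <= opnorm T.
Proof.
rewrite /opnorm; set E := (X in sup X).
have E0 : E (complex.Re `|T 0|) by exists 0 => //=; rewrite normr0.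
have [/ub_le_sup hE|nE] := pselect (has_ubound E).
  exact: le_trans (rnorm_ge0 (T 0)) (hE _ E0).
(* The supremum of an unbounded set takes the default value 0. *)
by rewrite sup_out// => -[].
Qed.

Lemma bounded_rnorm T : bounded_operator T ->
  exists2 M : R, 0 <= M & forall x, rnorm (T x) <= M * rnorm x.
Proof.
move=> [_ [M hM]]; exists `|M| => // x; rewrite -lecR -rnormE rmorphM /= -rnormE.
by rewrite (le_trans (hM x))// ler_wpM2r// lecR ler_norm.
Qed.

Lemma opnorm_bound T x : bounded_operator T ->
  rnorm (T x) <= opnorm T * rnorm x.
Proof.
move=> bT; have [M M0 hM] := bounded_rnorm bT; have [linT _] := bT.
have T0 : T 0 = 0 by have := linT (-1) 0 0; rewrite scaler0 addr0 scaleN1r addNr.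
have [->|x0] := eqVneq x 0; first by rewrite T0 rnorm0 mulr0.
have nx0 : 0 < rnorm x.
  by rewrite lt_def rnorm_ge0 andbT; apply: contra x0 => /eqP/rnorm_eq0 ->.
rewrite -ler_pdivrMr//.
have <- : rnorm (T ((rnorm x)^-1%:C *: x)) = rnorm (T x) / rnorm x.
  have -> : T ((rnorm x)^-1%:C *: x) = (rnorm x)^-1%:C *: T x.
    by have := linT (rnorm x)^-1%:C x 0; rewrite T0 !addr0.
  by rewrite rnormZ rnorm_real gtr0_norm ?invr_gt0// mulrC.
apply: ub_le_sup; last first.
  exists ((rnorm x)^-1%:C *: x) => //=.
  rewrite rnormE rnormZ rnorm_real gtr0_norm ?invr_gt0//.
  by rewrite mulVf ?gt_eqF.
exists M => _ [y /= y1 <-]; rewrite (le_trans (hM y))// ler_piMr//.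
by rewrite -lecR -rnormE.
Qed.

Lemma bounded_operatorD S T : bounded_operator S -> bounded_operator T ->
  bounded_operator (S + T).
Proof.
move=> bS bT; have [M _ hM] := bounded_rnorm bS; have [N _ hN] := bounded_rnorm bT.
have [lS _] := bS; have [lT _] := bT; split.
  by move=> c x y; rewrite /= !fctE lS lT scalerDr addrACA.
exists (M + N) => x; rewrite fctE !rnormE -rmorphM /= lecR.
by rewrite (le_trans (ler_rnormD _ _))// mulrDl lerD.
Qed.

Lemma bounded_operatorZ (c : R[i]) T : bounded_operator T ->
  bounded_operator (c *: T).
Proof.
move=> bT; have [M _ hM] := bounded_rnorm bT; have [lT _] := bT; split.
  by move=> d x y; rewrite /= !fctE lT scalerDr !scalerA mulrC.
exists (rnorm c * M) => x; rewrite fctE !rnormE -rmorphM /= lecR.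
by rewrite rnormZ -mulrA ler_wpM2l ?rnorm_ge0.
Qed.

Lemma bounded_operator0 : bounded_operator (0 : H -> H).
Proof.
have T0 x : (0 : H -> H) x = 0 by [].
split; first by move=> d x y; rewrite !T0 scaler0 addr0.
by exists 0 => x; rewrite T0 normr0 mul0r.
Qed.

Lemma bounded_operator_id : bounded_operator (idfun : H -> H).
Proof. by split; [|exists 1 => x; rewrite mul1r]. Qed.

Lemma bounded_operator_sum I (s : seq I) (P : pred I) (F : I -> H -> H) :
  (forall i, bounded_operator (F i)) ->
  bounded_operator (\sum_(i <- s | P i) F i).
Proof.
move=> h; elim/big_ind: _ => //; first exact: bounded_operator0.
exact: bounded_operatorD.
Qed.

Lemma bounded_operatorB S T : bounded_operator S -> bounded_operator T ->
  bounded_operator (S - T).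
Proof.
move=> bS bT; apply: bounded_operatorD => //; rewrite -scaleN1r.
exact: bounded_operatorZ.
Qed.

End OperatorNorm.

(** * Homogeneous parts along complex lines *)

Section HomogeneousParts.
Context {R : realType} {H : completeNormedModType R[i]} {n : nat}.
Variable A : {ffun 'I_n -> nat} -> H -> H.
Implicit Types z : 'rV[R[i]]_n.

Lemma homogeneous_part_bounded k z : (forall a, bounded_operator (A a)) ->
  bounded_operator (homogeneous_part A k z).
Proof.
by move=> bA; apply: bounded_operator_sum => a; exact: bounded_operatorZ.
Qed.

Lemma homogeneous_partZ k z (xi : R[i]) :
  homogeneous_part A k (xi *: z) = xi ^+ k *: homogeneous_part A k z.
Proof.
rewrite /homogeneous_part scaler_sumr; apply: eq_bigr => a /eqP ak.
rewrite scalerA; congr (_ *: _).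
under eq_bigr do rewrite mxE exprMn.
by rewrite big_split /= prodrXr ak.
Qed.

(** Passes from convergence in operator norm to convergence at each vector, the form in which the
    power series estimates apply. *)
Lemma homogeneous_expansion_cvg Q f z x :
  homogeneous_expansion Q f A -> Q z ->
  rnorm (f z x - \sum_(k < N) homogeneous_part A k z x) @[N --> \oo] --> (0 : R).
Proof.
move=> [bA bf cA] Qz; have := cA z Qz => hc.
have : (fun N => opnorm (f z - \sum_(k < N) homogeneous_part A k z) * rnorm x)
    @ \oo --> 0 * rnorm x by apply: cvgMl.
rewrite mul0r; apply: squeeze_cvgr; last exact: cvg_cst.
apply: nearW => N; rewrite rnorm_ge0 /=.
have -> : f z x - \sum_(k < N) homogeneous_part A k z x =
    (f z - \sum_(k < N) homogeneous_part A k z) x by rewrite !fctE fct_sumE.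
apply: opnorm_bound; apply: bounded_operatorB; first exact: bf.
by apply: bounded_operator_sum => k; exact: homogeneous_part_bounded.
Qed.

End HomogeneousParts.

(** * The numerical inequality *)

Section BohrSum.
Context {R : realType}.

Lemma geometric_tail_le (q : R) n : 0 <= q < 1 ->
  \sum_(1 <= k < n) q ^+ k <= q / (1 - q).
Proof.
move=> /andP[q0 q1]; have t0 : 0 < 1 - q by rewrite subr_gt0.
case: n => [|n]; first by rewrite big_geq// divr_ge0// ltW.
have -> : \sum_(1 <= k < n.+1) q ^+ k = (q - q ^+ n.+1) / (1 - q).
  elim: n => [|n IHn]; first by rewrite big_geq// expr1 subrr mul0r.
  rewrite big_nat_recr//= IHn [q ^+ n.+2]exprS; field.
  by rewrite subr_eq0 gt_eqF.
by rewrite ler_pM2r ?invr_gt0// gerBl exprn_ge0.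
Qed.

(** With [b = 1 - a ^+ 2], the sums are at most [a + b / 2] and [b ^+ 2 / 8]. As
    [a + b / 2 = 1 - (1 - a) ^+ 2 / 2], the weighted second sum only has to fit into the gap
    [(1 - a) ^+ 2 / 2]. *)
Lemma bohr_sum_le (p : nat -> R) (a r : R) : (forall k, 0 <= p k) ->
  0 <= a < 1 -> 0 <= r <= 1 / 3 -> p 0%N <= a ->
  (forall k, (0 < k)%N -> p k <= (1 - a ^+ 2) * r ^+ k) ->
  (\sum_(0 <= k <oo) (p k)%:E +
   (1 / (1 + a) + r / (1 - r))%:E * \sum_(1 <= k <oo) (p k ^+ 2)%:E <= 1)%E.
Proof.
move=> p0 /andP[a0 a1] /andP[r0 r3] pa pk.
pose b := 1 - a ^+ 2.
have b0 : 0 <= b by rewrite /b; nra.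
have r1 : r < 1 by lra.
(* The constants 1/2 and 1/8 are the values of the two geometric sums at [r = 1 / 3]. *)
have rr : r / (1 - r) <= 1 / 2 by rewrite ler_pdivrMr; lra.
have rr2 : r ^+ 2 / (1 - r ^+ 2) <= 1 / 8 by rewrite ler_pdivrMr; nra.
have sum1 : (\sum_(0 <= k <oo) (p k)%:E <= (a + b / 2)%:E)%E.
  apply: lime_le; first by apply: is_cvg_nneseries => k _ _; rewrite lee_fin.
  apply: nearW => -[|m]; first by rewrite big_geq// lee_fin; nra.
  rewrite sumEFin lee_fin big_ltn// lerD//.
  apply: le_trans (_ : b * (r / (1 - r)) <= _); last by nra.
  rewrite (le_trans _ (ler_wpM2l b0 (geometric_tail_le m.+1 _))) ?r0//.
  by rewrite mulr_sumr; apply: ler_sum_nat => k /andP[k0 _]; exact: pk.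
have sum2 : (\sum_(1 <= k <oo) (p k ^+ 2)%:E <= (b ^+ 2 / 8)%:E)%E.
  apply: lime_le.
    by apply: is_cvg_nneseries => k _ _; rewrite lee_fin sqr_ge0.
  apply: nearW => m; rewrite sumEFin lee_fin.
  apply: le_trans (_ : b ^+ 2 * (r ^+ 2 / (1 - r ^+ 2)) <= _); last by nra.
  rewrite (le_trans _ (ler_wpM2l (sqr_ge0 b) (geometric_tail_le m _)))//; last first.
    by rewrite sqr_ge0; nra.
  rewrite mulr_sumr; apply: ler_sum_nat => k /andP[k0 _].
  rewrite exprAC -exprMn -/b ler_sqr ?nnegrE ?mulr_ge0 ?exprn_ge0//.
  exact: pk.
set c := 1 / (1 + a) + r / (1 - r).
have c0 : 0 <= c by rewrite /c addr_ge0// divr_ge0//; lra.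
have cle : c <= 1 / (1 + a) + 1 / 2 by rewrite lerD2l.
apply: le_trans (leeD sum1 (lee_wpmul2l _ sum2)) _; first by rewrite lee_fin.
rewrite -EFinM -EFinD lee_fin.
have bE : b = (1 - a) * (1 + a) by rewrite /b; ring.
have h1 : (1 / (1 + a) + 1 / 2) * (b ^+ 2 / 8) =
    (1 - a) ^+ 2 * ((1 + a) + (1 + a) ^+ 2 / 2) / 8.
  by rewrite bE; field; lra.
(* Since [a < 1], the factor [(1 + a) + (1 + a) ^+ 2 / 2] in [h1] is at most 4. *)
have h2 : c * (b ^+ 2 / 8) <= (1 - a) ^+ 2 / 2.
  apply: le_trans (_ : (1 / (1 + a) + 1 / 2) * (b ^+ 2 / 8) <= _).
    by rewrite ler_wpM2r// divr_ge0// sqr_ge0.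
  rewrite h1 -mulrA ler_wpM2l ?sqr_ge0//; nra.
by move: h2; set X := c * _; rewrite bE; lra.
Qed.

End BohrSum.

Lemma bohr_inequality_third (R : realType) (H : completeNormedModType R[i])
    (dot : {dot H for Num.conj}) (dot_norm : forall x : H, dot x x = `|x| ^+ 2)
    (n : nat) (Q : set 'rV[R[i]]_n) (Qdomain : complete_circular_domain Q)
    (f : 'rV[R[i]]_n -> H -> H) (A : {ffun 'I_n -> nat} -> H -> H) (a0 : R[i])
    (r : R) (z : 'rV[R[i]]_n) :
  bohr_admissible Q f A a0 -> 0 <= r <= 1 / 3 -> homothetic r Q z ->
  bohr_inequality f A r z.
Proof.
move=> [fA f1 f0 a01] r3 [w Qw <-]; have [bA bf _] := fA.
have [_ _ Q0 _] := Qdomain.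
have [rho rho1 Qrho] := circular_domain_dilate Qdomain Qw.
have ra1 : rnorm a0 < 1 by rewrite -ltcR -rnormE.
have bP k z' : bounded_operator (homogeneous_part A k z').
  exact: homogeneous_part_bounded.
pose g (xi : R[i]) := f (xi *: w).
have g_cvg x (xi : R[i]) : rnorm xi <= rho ->
    rnorm (g xi x - \sum_(k < N) xi ^+ k *: homogeneous_part A k w x)
      @[N --> \oo] --> (0 : R).
  move=> /Qrho Qxi; have := homogeneous_expansion_cvg x fA Qxi.
  under eq_fun do under eq_bigr do rewrite homogeneous_partZ fctE.
  exact.
have P0 v : homogeneous_part A 0 w v = a0 *: v.
  have := @g_cvg v 0; rewrite rnorm0 => /(_ (ltW (lt_trans ltr01 rho1))) h.
  (* At [xi = 0] every nonempty partial sum equals the degree 0 part, so the limit identifies that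
     part with [f 0]; the empty sum [N = 0] is skipped. *)
  have : (fun N => rnorm (g 0 v - homogeneous_part A 0 w v)) @ \oo --> (0 : R).
    apply: cvg_trans h; apply: near_eq_cvg; exists 1%N => // -[//|N] _.
    rewrite big_ord_recl expr0 scale1r big1 ?addr0// => k _.
    by rewrite expr0n scale0r.
  move=> /(cvg_lim (@Rhausdorff R)); rewrite lim_cst; last exact: Rhausdorff.
  move=> /rnorm_eq0/eqP; rewrite subr_eq0 => /eqP <-.
  by rewrite /g scale0r f0 fctE.
have coef k x : (0 < k)%N -> rnorm (homogeneous_part A k w x) <=
    (1 - rnorm a0 ^+ 2) * rnorm x.
  move=> k0.
  apply: (@contractive_series_coef_le R H dot dot_norm
    (fun j => homogeneous_part A j w) g rho _ rho1 g_cvg _ a0 k x k0 P0 ra1).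
  - by move=> xi xi1; have [] := bf _ (Qrho xi _); rewrite ?xi1 ?ltW.
  - move=> xi v xi1; have Qxi : Q (xi *: w) by apply: Qrho; rewrite xi1 ltW.
    rewrite (le_trans (opnorm_bound v (bf _ Qxi)))// ler_piMl ?rnorm_ge0//.
    by rewrite ltW// f1.
have [r0 _] := andP r3.
(* Equality fails when [H] is zero and [a0] is not; the inequality suffices, since it only enlarges
   [1 - opnorm (f 0) ^+ 2]. *)
have f0a : opnorm (f 0) <= rnorm a0.
  by apply: opnorm_le (rnorm_ge0 _) _ => x; rewrite f0 fctE rnormZ.
apply: bohr_sum_le => //.
- by move=> k; exact: opnorm_ge0.
- by rewrite opnorm_ge0 f1.
- apply: opnorm_le => [|x]; first exact: opnorm_ge0.
  rewrite homogeneous_partZ expr0 scale1r P0.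
  have -> : a0 *: x = f 0 x by rewrite f0 fctE.
  exact/opnorm_bound/bf.
- move=> k k0; have B0 : 0 <= 1 - rnorm a0 ^+ 2.
    by rewrite subr_ge0 expr_le1 ?rnorm_ge0// ltW.
  apply: le_trans (_ : (1 - rnorm a0 ^+ 2) * r ^+ k <= _).
    apply: opnorm_le => [|x]; first by rewrite mulr_ge0// exprn_ge0.
    rewrite homogeneous_partZ fctE rnormZ rnormX rnorm_real ger0_norm//.
    by rewrite mulrAC [leRHS]mulrC ler_wpM2l ?exprn_ge0// coef.
  rewrite ler_wpM2r ?exprn_ge0// lerD2l lerN2.
  by rewrite ler_sqr ?nnegrE ?rnorm_ge0 ?opnorm_ge0.
Qed.

(** * Nearest exterior point and supporting hyperplane *)

Section ConvexDomain.
Context {R : realType} {n : nat}.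
Implicit Types (Q : set 'rV[R[i]]_n) (u z : 'rV[R[i]]_n).

Lemma rnorm_sqr (z : R[i]) :
  rnorm z ^+ 2 = complex.Re z ^+ 2 + complex.Im z ^+ 2.
Proof. by apply: complexI; rewrite rmorphXn /= -rnormE -add_Re2_Im2. Qed.

Lemma convex_segment Q (x y : 'rV[R[i]]_n) (t : R) : convex_set Q ->
  Q x -> Q y -> 0 <= t <= 1 -> Q ((1 - t)%:C *: x + t%:C *: y).
Proof.
move=> cQ Qx Qy /andP[t0 t1].
have tC0 : 0 <= (t%:C : R[i]) by rewrite ler0c.
have tC1 : (t%:C : R[i]) <= 1 by rewrite (lecR t 1).
have := cQ y x (Itv01 tC0 tC1) (mem_set Qy) (mem_set Qx).
by move/set_mem; rewrite /conv /= rmorphB /= addrC.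
Qed.

Definition sqnorm z : R := \sum_i rnorm (z 0 i) ^+ 2.

Definition cdot z u : R[i] := \sum_i z 0 i * (u 0 i)^*%R.

Lemma sqnormZ (c : R[i]) z : sqnorm (c *: z) = rnorm c ^+ 2 * sqnorm z.
Proof.
rewrite /sqnorm mulr_sumr; apply: eq_bigr => i _.
by rewrite mxE rnormM exprMn.
Qed.

Lemma cdotZ (c : R[i]) z u : cdot (c *: z) u = c * cdot z u.
Proof.
by rewrite /cdot mulr_sumr; apply: eq_bigr => i _; rewrite mxE mulrA.
Qed.

Lemma cdot_sqnorm u : cdot u u = (sqnorm u)%:C.
Proof.
rewrite /cdot /sqnorm rmorph_sum /=; apply: eq_bigr => i _.
exact: mulC_conj.
Qed.

Lemma sqnormB_real u z (t : R) : sqnorm (u - t%:C *: z) =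
  sqnorm u - 2 * t * complex.Re (cdot z u) + t ^+ 2 * sqnorm z.
Proof.
have -> : complex.Re (cdot z u) = \sum_i complex.Re (z 0 i * (u 0 i)^*%R).
  by rewrite /cdot; elim/big_rec2: _ => // i _ x _ <-; case: (_ * _); case: x.
rewrite /sqnorm !mulr_sumr -sumrN -!big_split /=; apply: eq_bigr => i _.
rewrite !mxE !rnorm_sqr; case: (u 0 i) => a b; case: (z 0 i) => c d /=.
by ring.
Qed.

(** Real coordinates on C^n, so that compactness of boxes and the extreme value theorem are applied
    to real rows. *)
Definition complex_row (v : 'rV[R]_(n + n)) : 'rV[R[i]]_n :=
  \row_i (v 0 (lshift n i) +i* v 0 (rshift n i)).

Lemma complex_row_open Q : open Q -> open (complex_row @^-1` Q).
Proof.
move=> oQ; rewrite openE => v /= Qv; have [e e0 he] := open_rV_ball oQ Qv.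
apply/nbhs_ballP; exists (e / 2); first by rewrite /= divr_gt0.
move=> v' [_ hv]; apply: he => i; rewrite !mxE.
have := hv 0 (lshift n i); have := hv 0 (rshift n i).
rewrite -!ball_normE /= => h1 h2.
set a := v 0 (lshift n i) in h2 *; set b := v 0 (rshift n i) in h1 *.
set c := v' 0 (lshift n i) in h2 *; set d := v' 0 (rshift n i) in h1 *.
have -> : (a +i* b) - (c +i* d) = (a - c)%:C + (b - d)%:C * 'i%C.
  by simpc.
rewrite (le_lt_trans (ler_rnormD _ _))// rnormM !rnorm_real.
have -> : rnorm ('i%C : R[i]) = 1.
  by rewrite /rnorm normc_def /= expr0n /= add0r expr1n sqrtr1.
by rewrite mulr1 (splitr e) ltrD.
Qed.

Lemma sqnorm_complex_row v : sqnorm (complex_row v) = \sum_i v 0 i ^+ 2.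
Proof.
rewrite big_split_ord /= -big_split /=; apply: eq_bigr => i _.
by rewrite mxE rnorm_sqr.
Qed.

Lemma complex_row_surj z : exists v, complex_row v = z.
Proof.
exists (row_mx (map_mx (@complex.Re R) z) (map_mx (@complex.Im R) z)).
apply/rowP => i; rewrite mxE row_mxEl row_mxEr !mxE.
by case: (z 0 i).
Qed.

(** The complement of [Q] is closed and nonempty; cut down to a large box it is compact, and the
    squared norm attains its minimum there. *)
Lemma nearest_outer_point Q : open Q -> Q <> setT ->
  exists2 u, ~ Q u & forall z, sqnorm z < sqnorm u -> Q z.
Proof.
move=> oQ QT; have [z0 nQ0] : exists z0, ~ Q z0.
  by apply/existsNP => h; apply: QT; apply/seteqP; split => // z _; exact: h.
have [v0 v0E] := complex_row_surj z0.
pose S := sqnorm z0; pose sq (v : 'rV[R]_(n + n)) := \sum_i v 0 i ^+ 2.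
have S0 : 0 <= S by apply: sumr_ge0 => i _; exact: sqr_ge0.
have sq_ge (v : 'rV[R]_(n + n)) i : v 0 i ^+ 2 <= sq v.
  by rewrite /sq (bigD1 i)//= lerDl sumr_ge0// => j _; exact: sqr_ge0.
have sq_v0 : sq v0 = S by rewrite /S -v0E sqnorm_complex_row.
(* A box of half-side [1 + S] contains every [v] with [sq v <= S], hence every exterior point at
   least as close to 0 as [z0]. *)
pose box := [set v : 'rV[R]_(n + n) | forall i, v ord0 i \in `[- (1 + S), 1 + S]].
have inbox v : sq v <= S -> box v.
  move=> vS i; rewrite in_itv /= -ler_norml.
  have := le_trans (sq_ge v i) vS; rewrite -real_normK ?num_real//.
  by move: (normr_ge0 (v 0 i)); set x := `|_|; nra.
have cbox : compact box.
  apply: (@rV_compact _ _ (fun=> `[(- (1 + S)), (1 + S)]%classic)).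
  by move=> _; exact: segment_compact.
pose K := box `&` ~` (complex_row @^-1` Q).
have cK : compact K.
  by apply: compact_closedI cbox _; apply: open_closedC; exact: complex_row_open.
have K0 : K !=set0.
  by exists v0; split; [apply: inbox; rewrite sq_v0|rewrite /= v0E].
have csq : {within K, continuous sq}.
  apply: continuous_subspaceT; apply: continuous_big => [|i _ v].
    exact: add_continuous.
  have vi := @coord_continuous R 1 (n + n) 0 i v.
  exact: (cvgM vi vi).
have [u /set_mem[_ nQu] minu] := EVT_min_rV K0 cK csq.
exists (complex_row u) => // z zu; apply: contrapT => nQz.
have [v vE] := complex_row_surj z.
move: zu nQz; rewrite -vE !sqnorm_complex_row -/(sq v) -/(sq u) => vu nQv.
have uS : sq u <= S.
  rewrite -sq_v0; apply: minu; apply: mem_set.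
  by split; [apply: inbox; rewrite sq_v0|rewrite /= v0E].
suff : sq u <= sq v by rewrite leNgt vu.
apply: minu; apply: mem_set; split=> //; apply: inbox.
by rewrite (le_trans (ltW vu)).
Qed.

(* The point u nearest to 0 outside Q defines a supporting hyperplane: if z in
   Q had <z, u> > |u|^2, then u would lie on a segment from z to a point closer
   to 0 than u. *)
Lemma nearest_outer_point_support Q u : complete_circular_domain Q ->
  convex_set Q -> ~ Q u -> (forall z, sqnorm z < sqnorm u -> Q z) ->
  forall z, Q z -> rnorm (cdot z u) < sqnorm u.
Proof.
move=> Qdomain cQ nQu hu z Qz; have [_ _ _ circ] := Qdomain.
rewrite ltNge; apply/negP => uz; apply: nQu.
have s0 : 0 <= sqnorm u by apply: sumr_ge0 => i _; exact: sqr_ge0.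
(* In the degenerate case [u = 0], which lies in [Q]. *)
have [h0|hn0] := eqVneq (rnorm (cdot z u)) 0.
  have /eqP u0 : sqnorm u == 0 by rewrite eq_le s0 andbT -h0.
  have -> : u = 0.
    apply/rowP => i; rewrite mxE; apply: rnorm_eq0; apply/eqP.
    rewrite -sqrf_eq0; move/eqP: u0; rewrite psumr_eq0 => [/allP|j _].
      by apply; rewrite mem_index_enum.
    exact: sqr_ge0.
  by have [] := Qdomain.
pose h := rnorm (cdot z u).
have hgt0 : 0 < h by rewrite lt_def hn0 rnorm_ge0.
(* A rotation of [z] makes the pairing with [u] real and positive. The dilation by [rho] below then
   turns [sqnorm u <= h] into the strict [sqnorm u < rho * h]. *)
pose z1 := ((cdot z u)^*%R / h%:C) *: z.
have Qz1 : Q z1.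
  apply: circ => //; rewrite rnormE rnormM -fmorphV /= rnorm_real.
  rewrite gtr0_norm ?invr_gt0//.
  have -> : rnorm (cdot z u)^*%R = h by rewrite /h /rnorm norm_conjC.
  by rewrite divff ?gt_eqF.
have dz1 : cdot z1 u = h%:C.
  rewrite cdotZ mulrAC [_^*%R * _]mulrC mulC_conj -/h rmorphXn /= expr2 mulfK//.
  by rewrite fmorph_eq0 gt_eqF.
have [rho rho1 Qrho] := circular_domain_dilate Qdomain Qz1.
have Qz2 : Q (rho%:C *: z1).
  by apply: Qrho; rewrite rnorm_real gtr0_norm// (lt_trans _ rho1).
pose z2 := rho%:C *: z1.
have dz2 : complex.Re (cdot z2 u) = rho * h by rewrite cdotZ dz1 -rmorphM.
pose gap := rho * h - sqnorm u.
have gap0 : 0 < gap by rewrite subr_gt0 (le_lt_trans uz)// ltr_pMl.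
have sz0 : 0 <= sqnorm z2 by apply: sumr_ge0 => i _; exact: sqr_ge0.
(* The point [v] below is closer to 0 than [u] as soon as [t * sqnorm z2 < 2 * gap + t * sqnorm u];
   the bound 1/2 keeps [1 - t] positive. *)
pose t := Num.min (1 / 2) (gap / (1 + sqnorm z2)).
have sz1 : 0 < 1 + sqnorm z2 by rewrite ltr_pwDl.
have t0 : 0 < t by rewrite lt_min !divr_gt0.
have t2 : t <= 1 / 2 by rewrite ge_min lexx.
have t1 : 0 < 1 - t by lra.
have tg : t * sqnorm z2 <= gap.
  have : t <= gap / (1 + sqnorm z2) by rewrite ge_min lexx orbT.
  by rewrite ler_pdivlMr//; nra.
pose v := (1 - t)^-1%:C *: (u - t%:C *: z2).
have tC : (1 - t)%:C != 0 :> R[i] by rewrite fmorph_eq0 gt_eqF.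
have uE : u = (1 - t)%:C *: v + t%:C *: z2.
  by rewrite /v scalerA fmorphV /= mulfV// scale1r subrK.
rewrite uE; apply: convex_segment => //; last first.
  by rewrite ltW//=; lra.
apply: hu; rewrite /v sqnormZ rnorm_real sqnormB_real dz2.
rewrite gtr0_norm ?invr_gt0// exprVn ltr_pdivrMl ?exprn_gt0//.
have -> : rho * h = gap + sqnorm u by rewrite /gap subrK.
have : t * (t * sqnorm z2) <= t * gap by rewrite ler_pM2l.
have : 0 < t * gap by rewrite mulr_gt0.
have : 0 <= t ^+ 2 * sqnorm u by rewrite mulr_ge0// sqr_ge0.
by lra.
Qed.

End ConvexDomain.

(** * Power series in a linear functional as homogeneous expansions *)

Section LinearFunctional.
Context {R : realType} {H : completeNormedModType R[i]} {n : nat}.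
Variable c : 'rV[R[i]]_n.
Implicit Types z : 'rV[R[i]]_n.

Definition lfun z : R[i] := \sum_i z 0 i * c 0 i.

Definition fibre_count k (s : {ffun 'I_k -> 'I_n}) : {ffun 'I_n -> nat} :=
  [ffun i => #|[pred j | s j == i]|].

(* The coefficient of z^al in (\sum_i c_i z_i)^k, as a sum over the words with
   letter counts al rather than as a multinomial coefficient times c^al. *)
Definition lfun_exp_coef k (al : {ffun 'I_n -> nat}) : R[i] :=
  \sum_(s : {ffun 'I_k -> 'I_n} | fibre_count s == al) \prod_j c 0 (s j).

Lemma lfun_exp k z : lfun z ^+ k =
  \sum_(a : {ffun 'I_n -> 'I_k.+1} | (\sum_(i < n) a i)%N == k)
    (\prod_(i < n) z 0 i ^+ a i) * lfun_exp_coef k [ffun i => a i : nat].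
Proof.
transitivity (\sum_(s : {ffun 'I_k -> 'I_n})
    \prod_(i < n) z 0 i ^+ fibre_count s i * \prod_j c 0 (s j)).
  have -> : lfun z ^+ k = \prod_(j < k) lfun z by rewrite prodr_const card_ord.
  rewrite /lfun bigA_distr_bigA /=; apply: eq_bigr => s _.
  rewrite big_split /=; congr (_ * _).
  rewrite (partition_big s xpredT)//=; apply: eq_bigr => i _.
  rewrite ffunE -prodr_const; apply: eq_big => // j.
  by move=> /eqP ->.
have count_le (s : {ffun 'I_k -> 'I_n}) i : (fibre_count s i < k.+1)%N.
  by rewrite ltnS ffunE (leq_trans (max_card _))// card_ord.
pose cnt (s : {ffun 'I_k -> 'I_n}) : {ffun 'I_n -> 'I_k.+1} :=
  [ffun i => Ordinal (count_le s i)].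
have cntE s a : (cnt s == a) = (fibre_count s == [ffun i => a i : nat]).
  apply/eqP/eqP => [<-|/ffunP h]; apply/ffunP => i.
    by rewrite !ffunE /= ffunE.
  by apply: val_inj; rewrite ffunE /= h ffunE.
rewrite (partition_big cnt (fun a => (\sum_(i < n) a i)%N == k)) /=.
  apply: eq_bigr => a _; rewrite /lfun_exp_coef mulr_sumr.
  apply: eq_big => [s|s]; rewrite cntE// => /eqP ->.
  by congr (_ * _); apply: eq_bigr => i _; rewrite ffunE.
move=> s _; apply/eqP; under eq_bigr do rewrite ffunE /= ffunE.
rewrite -[RHS]card_ord -sum1_card (partition_big s xpredT)//=.
by apply: eq_bigr => i _; rewrite -sum1_card; apply: eq_bigl => j; rewrite inE.
Qed.

(** The multi-index coefficients of \sum_k e_k l^k I; the degree k is recovered as the sum of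
    [al]. *)
Definition lfun_series_coef (e : nat -> R[i]) (al : {ffun 'I_n -> nat}) : H -> H :=
  (e (\sum_i al i)%N * lfun_exp_coef (\sum_i al i)%N al) *: idfun.

Lemma homogeneous_part_lfun_series e k z :
  homogeneous_part (lfun_series_coef e) k z = (e k * lfun z ^+ k) *: idfun.
Proof.
rewrite lfun_exp mulr_sumr scaler_suml; apply: eq_bigr => a /eqP ak.
rewrite /lfun_series_coef scalerA; congr (_ *: _).
have -> : (\sum_i [ffun i0 => a i0 : nat] i)%N = k.
  by rewrite -[RHS]ak; apply: eq_bigr => i _; rewrite ffunE.
by rewrite mulrCA.
Qed.

End LinearFunctional.

(** * The disc automorphism exchanging 0 and [a], and its Taylor series *)

Section Moebius.
Context {R : realType}.
Variable a : R.
Hypothesis a01 : 0 < a < 1.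

Definition moebius (x : R[i]) : R[i] := (a%:C - x) / (1 - a%:C * x).

Definition moebius_coef k : R[i] :=
  if k is j.+1 then (- ((1 - a ^+ 2) * a ^+ j))%:C else a%:C.

Lemma moebius_den_neq0 x : rnorm x < 1 -> 1 - a%:C * x != 0.
Proof.
move=> x1; apply/eqP => /subr0_eq/esym h.
have /andP[a0 a1] := a01.
have := congr1 rnorm h; rewrite rnormM rnorm1 rnorm_real gtr0_norm//.
by have := rnorm_ge0 x; nra.
Qed.

(** This rests on |1 - a x|^2 - |a - x|^2 = (1 - a^2) (1 - |x|^2). *)
Lemma moebius_lt1 x : rnorm x < 1 -> rnorm (moebius x) < 1.
Proof.
move=> x1; have d0 := moebius_den_neq0 x1; have /andP[a0 a1] := a01.
have d1 : 0 < rnorm (1 - a%:C * x).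
  by rewrite lt_def rnorm_ge0 andbT; apply: contra d0 => /eqP/rnorm_eq0 ->.
have -> : rnorm (moebius x) = rnorm (a%:C - x) / rnorm (1 - a%:C * x).
  by apply: (mulIf (lt0r_neq0 d1)); rewrite -rnormM !divfK// gt_eqF.
rewrite ltr_pdivrMr// mul1r -ltr_sqr ?nnegrE ?rnorm_ge0//.
have : rnorm x ^+ 2 < 1 by rewrite expr_lt1// rnorm_ge0.
rewrite !rnorm_sqr; case: x {x1 d0 d1} => x y /= xy1.
have : 0 < (1 - a ^+ 2) * (1 - (x ^+ 2 + y ^+ 2)).
  by rewrite mulr_gt0// subr_gt0// expr_lt1// ltW.
by lra.
Qed.

Lemma moebius_sum x N : rnorm x < 1 ->
  moebius x - \sum_(k < N.+1) moebius_coef k * x ^+ k =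
  - ((1 - a ^+ 2) * a ^+ N)%:C * x ^+ N.+1 / (1 - a%:C * x).
Proof.
move=> x1; have d0 := moebius_den_neq0 x1.
elim: N => [|N IHN].
  rewrite big_ord_recl big_ord0 /= /moebius !expr0 expr1 !mulr1 addr0.
  by rewrite rmorphB rmorph1 rmorphXn /=; field.
rewrite big_ord_recr /= opprD addrA IHN.
rewrite rmorphN !rmorphM !rmorphB !rmorph1 !rmorphXn /= !exprS; field.
exact: d0.
Qed.

Lemma moebius_series_cvg x : rnorm x < 1 ->
  rnorm (moebius x - \sum_(k < N) moebius_coef k * x ^+ k) @[N --> \oo]
    --> (0 : R).
Proof.
move=> x1; have d0 := moebius_den_neq0 x1; have /andP[a0 a1] := a01.
rewrite -cvg_shiftS /=.
pose M := rnorm (1 - a%:C * x)^-1.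
have : (fun N => a ^+ N * M) @ \oo --> 0 * M.
  by apply: cvgMl; apply: cvg_expr; rewrite gtr0_norm.
rewrite mul0r; apply: squeeze_cvgr; last exact: cvg_cst.
apply: nearW => N; rewrite rnorm_ge0 /= moebius_sum// rnormM.
rewrite ler_wpM2r ?rnorm_ge0// rnormM rnormN rnorm_real rnormX.
have aN0 : 0 <= a ^+ N by rewrite exprn_ge0// ltW.
have xN : rnorm x ^+ N.+1 <= 1 by rewrite exprn_ile1 ?rnorm_ge0// ltW.
have xN0 : 0 <= rnorm x ^+ N.+1 by rewrite exprn_ge0// rnorm_ge0.
have a2 : 0 <= 1 - a ^+ 2 <= 1 by nra.
have /andP[a20 a21] := a2.
rewrite ger0_norm ?mulr_ge0//.
rewrite -[leRHS]mulr1 ler_pM ?mulr_ge0//.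
by rewrite ler_piMl.
Qed.

(** The full sum is [a + (1 - a ^+ 2) * tau / (1 - a * tau)], which exceeds 1 exactly when
    [tau * (1 + 2 * a)] does; a long enough partial sum then exceeds 1 too. *)
Lemma moebius_coef_sum_gt1 (tau : R) : 0 <= tau < 1 -> 1 < tau * (1 + 2 * a) ->
  exists N, 1 < \sum_(k < N) rnorm (moebius_coef k) * tau ^+ k.
Proof.
move=> /andP[tau0 tau1] ht; have /andP[a0 a1] := a01.
pose q := a * tau.
have q0 : 0 <= q by rewrite mulr_ge0// ltW.
have q1 : q < 1 by rewrite /q; nra.
have d0 : 0 < 1 - q by rewrite subr_gt0.
have sumE N : \sum_(k < N.+1) rnorm (moebius_coef k) * tau ^+ k =
    a + (1 - a ^+ 2) * tau * (1 - q ^+ N) / (1 - q).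
  elim: N => [|N IHN].
    rewrite big_ord_recl big_ord0 /= !expr0 subrr mulr0 mul0r !addr0 mulr1.
    by rewrite rnorm_real gtr0_norm.
  rewrite big_ord_recr /= IHN rnorm_real normrN ger0_norm; last first.
    by rewrite mulr_ge0 ?exprn_ge0 ?ltW//; nra.
  rewrite [q ^+ N.+1]exprS [tau ^+ N.+1]exprS.
  have -> : q ^+ N = a ^+ N * tau ^+ N by rewrite exprMn.
  by rewrite /q; field; move: d0; rewrite /q; lra.
(* [gap] equals [(1 + a) * tau - (1 - q)]. Truncation costs at most [2 * q ^+ N], so
   [q ^+ N <= gap / 4] leaves half of it. *)
pose gap := tau * (1 + 2 * a) - 1.
have gap0 : 0 < gap by rewrite subr_gt0.
have [N _ hN] : \forall N \near \oo, `|q ^+ N| <= gap / 4.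
  have /cvgr0Pnorm_le : (fun N => q ^+ N) @ \oo --> (0 : R).
    by apply: cvg_expr; rewrite ger0_norm.
  by apply; rewrite divr_gt0.
exists N.+1; rewrite sumE -ltrBlDl ltr_pdivlMr//.
have := hN N (leqnn N); rewrite ger0_norm ?exprn_ge0//.
set p := q ^+ N => hp; have p0 : 0 <= p by rewrite exprn_ge0.
have -> : (1 - a ^+ 2) * tau * (1 - p) = (1 - a) * ((1 + a) * tau * (1 - p)).
  by ring.
rewrite ltr_pM2l ?subr_gt0//.
have : (1 + a) * tau * p <= 2 * p by rewrite ler_wpM2r//; nra.
by move: hp; rewrite /q /gap in gap0 *; lra.
Qed.

End Moebius.

(** * Scalar multiples of the identity *)

Section ScalarOperators.
Context {R : realType} {H : completeNormedModType R[i]}.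

Lemma opnorm_scalar_le (c : R[i]) : opnorm (c *: (idfun : H -> H)) <= rnorm c.
Proof. by apply: opnorm_le (rnorm_ge0 _) _ => x; rewrite fctE rnormZ. Qed.

Lemma bounded_operator_scalar (c : R[i]) :
  bounded_operator (c *: (idfun : H -> H)).
Proof. exact/bounded_operatorZ/bounded_operator_id. Qed.

Lemma opnorm_scalar (c : R[i]) : (exists x : H, x <> 0) ->
  opnorm (c *: (idfun : H -> H)) = rnorm c.
Proof.
move=> [x x0]; apply/eqP; rewrite eq_le opnorm_scalar_le /=.
have := opnorm_bound x (bounded_operator_scalar c).
rewrite fctE rnormZ ler_pM2r// lt_def rnorm_ge0 andbT.
by apply/eqP => /rnorm_eq0.
Qed.

End ScalarOperators.

(** * The extremal functions *)

Section MoebiusFamily.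
Context {R : realType} {H : completeNormedModType R[i]} {n : nat}.
Variables (Q : set 'rV[R[i]]_n) (c : 'rV[R[i]]_n) (a : R).
Hypothesis lfun_lt1 : forall z, Q z -> rnorm (lfun c z) < 1.
Hypothesis a01 : 0 < a < 1.

Definition moebius_operator (z : 'rV[R[i]]_n) : H -> H :=
  moebius a (lfun c z) *: idfun.

Lemma moebius_admissible : bohr_admissible Q moebius_operator
  (lfun_series_coef c (moebius_coef a)) a%:C.
Proof.
have /andP[a0 a1] := a01.
split; [split| | |].
- by move=> al; exact: bounded_operator_scalar.
- by move=> z _; exact: bounded_operator_scalar.
- move=> z /lfun_lt1 z1; have := moebius_series_cvg a01 z1.
  apply: squeeze_cvgr; last exact: cvg_cst.
  apply: nearW => N; rewrite opnorm_ge0 /=.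
  under eq_bigr do rewrite homogeneous_part_lfun_series.
  by rewrite -scaler_suml -scalerBl opnorm_scalar_le.
- move=> z /lfun_lt1 z1.
  by rewrite (le_lt_trans (opnorm_scalar_le _))// moebius_lt1.
- rewrite /moebius_operator /lfun big1 => [|i _]; last by rewrite mxE mul0r.
  by rewrite /moebius mulr0 !subr0 divr1.
- by rewrite rnormE rnorm_real gtr0_norm// (ltcR a 1).
Qed.

(** The first series alone exceeds 1, and the quadratic term is nonnegative. *)
Lemma moebius_bohr_fails (r tau : R) z : (exists x : H, x <> 0) ->
  0 <= r < 1 -> 0 <= tau < 1 -> 1 < tau * (1 + 2 * a) ->
  lfun c z = tau%:C ->
  ~ bohr_inequality moebius_operator (lfun_series_coef c (moebius_coef a)) r z.
Proof.
move=> H0 /andP[r0 r1] tau01 ht zE; have [N hN] := moebius_coef_sum_gt1 a01 tau01 ht.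
rewrite /bohr_inequality; set S1 := (\sum_(0 <= k <oo) _)%E.
set S2 := (\sum_(1 <= k <oo) _)%E; move=> h.
have S2_ge0 : (0 <= S2)%E.
  by apply: nneseries_ge0 => k _ _; rewrite lee_fin sqr_ge0.
have : (S1 <= 1)%E.
  apply: le_trans h; rewrite leeDl// mule_ge0// lee_fin.
  by rewrite addr_ge0// divr_ge0// ?subr_ge0 ?addr_ge0 ?opnorm_ge0 ?ltW.
apply/negP; rewrite -ltNge.
apply: lt_le_trans (@nneseries_lim_ge _ _ _ 0%N N _); last first.
  by move=> k _ _; rewrite lee_fin opnorm_ge0.
rewrite sumEFin lte_fin big_mkord (lt_le_trans hN)// ler_sum// => k _.
rewrite homogeneous_part_lfun_series opnorm_scalar// rnormM rnormX zE.
by have /andP[tau0 _] := tau01; rewrite rnorm_real (ger0_norm tau0).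
Qed.

End MoebiusFamily.

(** The sharpness half excludes two degenerate cases in which no counterexample exists: on all of
    C^n a bounded [f] is constant by Liouville, and on the zero space all operator norms vanish. *)
Theorem theorem2p4 (R : realType) (H : completeNormedModType R[i])
    (dot : {dot H for Num.conj})
    (dot_norm : forall x : H, dot x x = `|x| ^+ 2)
    (n : nat) (Q : set 'rV[R[i]]_n) (Qdomain : complete_circular_domain Q) :
  (forall (f : 'rV[R[i]]_n -> H -> H) (A : {ffun 'I_n -> nat} -> H -> H)
      (a0 : R[i]),
    bohr_admissible Q f A a0 ->
    forall r : R, 0 <= r <= 1 / 3 ->
    forall z : 'rV[R[i]]_n, homothetic r Q z -> bohr_inequality f A r z)
  /\
  (convex_set Q -> Q <> setT -> (exists x : H, x <> 0) ->
    forall r : R, 1 / 3 < r < 1 ->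
    exists (f : 'rV[R[i]]_n -> H -> H) (A : {ffun 'I_n -> nat} -> H -> H)
        (a0 : R[i]),
      bohr_admissible Q f A a0 /\
      exists2 z : 'rV[R[i]]_n, homothetic r Q z & ~ bohr_inequality f A r z).
Proof.
split; first by move=> f A a0 fA r r3 z rz; exact: bohr_inequality_third fA r3 rz.
move=> cQ QT H0 r /andP[r3 r1]; have [oQ _ Q0 _] := Qdomain.
have [u nQu hu] := nearest_outer_point oQ QT.
have support := nearest_outer_point_support Qdomain cQ nQu hu.
have sigma0 : 0 < sqnorm u by exact: le_lt_trans (rnorm_ge0 _) (support 0 Q0).
pose c : 'rV[R[i]]_n := \row_i ((u 0 i)^*%R / (sqnorm u)%:C).
have lfunE z : lfun c z = cdot z u / (sqnorm u)%:C.
  by rewrite /lfun mulr_suml; apply: eq_bigr => i _; rewrite mxE mulrA.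
have lfun_lt1 z : Q z -> rnorm (lfun c z) < 1.
  move=> /support zu; rewrite lfunE rnormM -fmorphV /= rnorm_real.
  by rewrite gtr0_norm ?invr_gt0// ltr_pdivrMr// mul1r.
have r0 : 0 < r by lra.
(* Any [tau] strictly between 1/3 and [r] works. Then [(tau^-1 - 1) / 2 < 1], and [a] is the
   midpoint between this threshold and 1. *)
pose tau := (r + 1 / 3) / 2.
have tau3 : 1 / 3 < tau by rewrite /tau; lra.
have taur : tau < r by rewrite /tau; lra.
have tau0 : 0 < tau by lra.
pose a := (1 + (tau^-1 - 1) / 2) / 2.
have tauV : 1 < tau^-1 < 3.
  rewrite invf_gt1//; apply/andP; split; first by lra.
  by rewrite -[3]invrK ltf_pV2 ?posrE//; lra.
have a01 : 0 < a < 1 by rewrite /a; lra.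
have ha : 1 < tau * (1 + 2 * a).
  have : tau^-1 < 1 + 2 * a by rewrite /a; lra.
  by rewrite -(ltr_pM2l tau0 tau^-1) mulfV ?gt_eqF.
exists (moebius_operator c a), (lfun_series_coef c (moebius_coef a)), a%:C.
split; first exact: moebius_admissible.
(* The factor [s < 1] puts [s *: u] inside [Q], and the functional takes the value [r * s = tau] at
   [r *: (s *: u)]. *)
pose s := tau / r.
have s0 : 0 < s by rewrite divr_gt0.
have s1 : s < 1 by rewrite /s ltr_pdivrMr// mul1r.
exists (r%:C *: (s%:C *: u)).
  exists (s%:C *: u) => //; apply: hu; rewrite sqnormZ rnorm_real gtr0_norm//.
  by rewrite gtr_pMl// expr_lt1// ltW.
apply: (@moebius_bohr_fails _ _ _ _ _ a01 r tau) => //; [lra|lra|].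
rewrite lfunE !cdotZ cdot_sqnorm mulrA mulfK ?fmorph_eq0 ?gt_eqF//.
by rewrite -rmorphM /= /s mulrC divfK ?gt_eqF.
Qed.
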